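(* Let $\mathfrak{C}$ be a tensor category over a field $k$ and let $A$ be an algebra in $\mathfrak{C}$. (a) If $A$ is an Azumaya algebra with $\tilde{\eta}(A)=1$ and the functor $\mathfrak{C}\to{}_A\mathrm{Mod}_A$, $X\mapsto X\otimes A$, is an equivalence, then $A$ admits an S-structure. (b) If $A$ admits an S-structure then $A$ is an Azumaya algebra with $\tilde{\eta}(A)=1$.
   Context: A tensor category over $k$ is an additive $k$-linear category with a $k$-bilinear symmetric monoidal structure $\otimes$ with unit $\mathbf{1}$ such that $\mathrm{End}(\mathbf{1})=k$. Put $\Gamma(X)=\mathrm{Hom}(\mathbf{1},X)$. Algebras are associative and unital, not necessarily commutative; $A\otimes A$ is an algebra via $(a\otimes b)(c\otimes d)=ac\otimes bd$ (using the symmetry). ${}_A\mathrm{Mod}_A$ is the category of $(A,A)$-bimodules. An S-structure on an algebra $A$ (with multiplication $\mu$) is a pair $(\pi,\epsilon)$ with $\pi\in\Gamma(A\otimes A)$ and $\epsilon\colon A\to\mathbf{1}$ such that $\tau=\lambda_\pi\rho_\pi$ and $\mu=(\mathrm{id}\otimes\epsilon)\rho_\pi$, where $\tau$ is the symmetry of $A\otimes A$ and $\lambda_\pi,\rho_\pi$ are left and right multiplication by $\pi$ on $A\otimes A$. An Azumaya algebra is an algebra $A$ whose underlying object is rigid (has a dual) and for which the natural map $A\otimes A^{\mathrm{op}}\to\underline{\mathrm{End}}(A)=A\otimes A^*$, $a\otimes b\mapsto(x\mapsto axb)$, is an isomorphism. The condition $\tilde\eta(A)=1$: put $B=A\otimes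 A$, with its symmetry automorphism $\tau\colon B\to B$ (an algebra automorphism). For a $B$-bimodule $M$, let $M^\dagger$ be the $B$-bimodule with the same underlying object and left action, but with the right action twisted by $\tau$. Then $\tilde\eta(A)=1$ means that there is an isomorphism of $B$-bimodules $i\colon B\to B^\dagger$ with $i^2=\mathrm{id}$ (as an endomorphism of the underlying object). *)

(* Defs.v *)
From mathcomp Require Import all_boot all_algebra.

Set Implicit Arguments.
Unset Strict Implicit.
Unset Printing Implicit Defensive.

Import GRing.Theory.
Local Open Scope ring_scope.

Declare Scope tcat_scope.
Delimit Scope tcat_scope with tcat.

Record category := Category {
  cat_ob :> Type;
  cat_hom : cat_ob -> cat_ob -> Type;
  cat_id : forall X, cat_hom X X;
  cat_comp : forall X Y Z, cat_hom Y Z -> cat_hom X Y -> cat_hom X Z;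
  cat_comp1m : forall X Y (f : cat_hom X Y), cat_comp (cat_id Y) f = f;
  cat_compm1 : forall X Y (f : cat_hom X Y), cat_comp f (cat_id X) = f;
  cat_compA : forall X Y Z W (h : cat_hom Z W) (g : cat_hom Y Z)
      (f : cat_hom X Y),
    cat_comp h (cat_comp g f) = cat_comp (cat_comp h g) f
}.

Record functor (C D : category) := Functor {
  fun_ob :> C -> D;
  fun_hom : forall X Y : C, cat_hom X Y -> cat_hom (fun_ob X) (fun_ob Y);
  fun_id : forall X, fun_hom (cat_id X) = cat_id (fun_ob X);
  fun_comp : forall (X Y Z : C) (g : cat_hom Y Z) (f : cat_hom X Y),
    fun_hom (cat_comp g f) = cat_comp (fun_hom g) (fun_hom f)
}.

Definition id_functor (C : category) : functor C C :=
  @Functor C C id (fun _ _ f => f) (fun _ => erefl) (fun _ _ _ _ _ => erefl).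

Section CompFunctor.
Variables (C D E : category) (G : functor D E) (F : functor C D).

Fact comp_functor_id (X : C) : fun_hom G (fun_hom F (cat_id X)) = cat_id (G (F X)).
Proof. by rewrite !fun_id. Qed.

Fact comp_functor_comp (X Y Z : C) (g : cat_hom Y Z) (f : cat_hom X Y) :
  fun_hom G (fun_hom F (cat_comp g f)) =
  cat_comp (fun_hom G (fun_hom F g)) (fun_hom G (fun_hom F f)).
Proof. by rewrite !fun_comp. Qed.

Definition comp_functor : functor C E :=
  @Functor C E (fun X => G (F X)) (fun _ _ f => fun_hom G (fun_hom F f))
    comp_functor_id comp_functor_comp.
End CompFunctor.

Definition cat_is_iso (C : category) (X Y : C) (f : cat_hom X Y) : Prop :=
  exists g : cat_hom Y X, cat_comp g f = cat_id X /\ cat_comp f g = cat_id Y.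

Definition naturally_isomorphic (C D : category) (F G : functor C D) : Prop :=
  exists t : forall X : C, cat_hom (F X) (G X),
    (forall (X Y : C) (f : cat_hom X Y),
       cat_comp (t Y) (fun_hom F f) = cat_comp (fun_hom G f) (t X)) /\
    (forall X, cat_is_iso (t X)).

Definition is_equivalence (C D : category) (F : functor C D) : Prop :=
  exists G : functor D C,
    naturally_isomorphic (id_functor C) (comp_functor G F) /\
    naturally_isomorphic (comp_functor F G) (id_functor D).

Record linearCategory (k : fieldType) := LinearCategory {
  ob :> Type;
  hom : ob -> ob -> lmodType k;
  idm : forall X, hom X X;
  comp : forall X Y Z, hom Y Z -> hom X Y -> hom X Z;
  comp1m : forall X Y (f : hom X Y), comp (idm Y) f = f;
  compm1 : forall X Y (f : hom X Y), comp f (idm X) = f;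
  compA : forall X Y Z W (h : hom Z W) (g : hom Y Z) (f : hom X Y),
    comp h (comp g f) = comp (comp h g) f;
  comp_linear_l : forall X Y Z (f : hom X Y),
    linear (fun g : hom Y Z => comp g f);
  comp_linear_r : forall X Y Z (g : hom Y Z),
    linear (fun f : hom X Y => comp g f)
}.

Arguments idm {k l} X.

Notation "g ∘ f" := (comp g f)
  (at level 40, left associativity) : tcat_scope.

Local Open Scope tcat_scope.

Definition underlying (k : fieldType) (C : linearCategory k) : category :=
  @Category C (fun X Y => hom X Y) (fun X => idm X) (@comp k C)
    (@comp1m k C) (@compm1 k C) (@compA k C).

Section Linear.
Variables (k : fieldType) (C : linearCategory k).

Definition is_iso (X Y : C) (f : hom X Y) : Prop :=
  exists g : hom Y X, g ∘ f = idm X /\ f ∘ g = idm Y.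

Definition is_zero_object (Z : C) : Prop :=
  (forall (X : C) (f : hom X Z), f = 0) /\ (forall (X : C) (f : hom Z X), f = 0).

Definition is_biproduct (X Y S : C) (i1 : hom X S) (i2 : hom Y S)
    (p1 : hom S X) (p2 : hom S Y) : Prop :=
  [/\ p1 ∘ i1 = idm X, p2 ∘ i2 = idm Y, p1 ∘ i2 = 0, p2 ∘ i1 = 0
    & i1 ∘ p1 + i2 ∘ p2 = idm S].

Definition is_additive : Prop :=
  (exists Z : C, is_zero_object Z) /\
  (forall X Y : C, exists (S : C) (i1 : hom X S) (i2 : hom Y S)
     (p1 : hom S X) (p2 : hom S Y), is_biproduct i1 i2 p1 p2).

End Linear.

Reserved Notation "X ⊗ Y" (at level 38, left associativity).
Reserved Notation "f ⊠ g" (at level 38, left associativity).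

(* The monoidal structure is not assumed strict. *)
Record symMonoidal (k : fieldType) (C : linearCategory k) := SymMonoidal {
  sm_unit : C;
  sm_tens : C -> C -> C
    where "X ⊗ Y" := (sm_tens X Y);
  sm_tensm : forall X X' Y Y' : C,
    hom X X' -> hom Y Y' -> hom (X ⊗ Y) (X' ⊗ Y')
    where "f ⊠ g" := (sm_tensm f g);
  sm_assoc : forall X Y Z : C, hom ((X ⊗ Y) ⊗ Z) (X ⊗ (Y ⊗ Z));
  sm_associ : forall X Y Z : C, hom (X ⊗ (Y ⊗ Z)) ((X ⊗ Y) ⊗ Z);
  sm_lunit : forall X : C, hom (sm_unit ⊗ X) X;
  sm_luniti : forall X : C, hom X (sm_unit ⊗ X);
  sm_runit : forall X : C, hom (X ⊗ sm_unit) X;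
  sm_runiti : forall X : C, hom X (X ⊗ sm_unit);
  sm_braid : forall X Y : C, hom (X ⊗ Y) (Y ⊗ X);

  sm_tensm_id : forall X Y : C, idm X ⊠ idm Y = idm (X ⊗ Y);
  sm_tensm_comp : forall (X X' X'' Y Y' Y'' : C) (f' : hom X' X'')
      (f : hom X X') (g' : hom Y' Y'') (g : hom Y Y'),
    (f' ∘ f) ⊠ (g' ∘ g) = (f' ⊠ g') ∘ (f ⊠ g);
  sm_tensm_linear_l : forall (X X' Y Y' : C) (g : hom Y Y'),
    linear (fun f : hom X X' => f ⊠ g);
  sm_tensm_linear_r : forall (X X' Y Y' : C) (f : hom X X'),
    linear (fun g : hom Y Y' => f ⊠ g);

  sm_assocK : forall X Y Z : C, sm_associ X Y Z ∘ sm_assoc X Y Z = idm _;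
  sm_associK : forall X Y Z : C, sm_assoc X Y Z ∘ sm_associ X Y Z = idm _;
  sm_lunitK : forall X : C, sm_luniti X ∘ sm_lunit X = idm _;
  sm_lunitiK : forall X : C, sm_lunit X ∘ sm_luniti X = idm _;
  sm_runitK : forall X : C, sm_runiti X ∘ sm_runit X = idm _;
  sm_runitiK : forall X : C, sm_runit X ∘ sm_runiti X = idm _;
  sm_braidK : forall X Y : C, sm_braid Y X ∘ sm_braid X Y = idm _;

  sm_assoc_nat : forall (X X' Y Y' Z Z' : C) (f : hom X X') (g : hom Y Y')
      (h : hom Z Z'),
    sm_assoc X' Y' Z' ∘ ((f ⊠ g) ⊠ h) = (f ⊠ (g ⊠ h)) ∘ sm_assoc X Y Z;
  sm_lunit_nat : forall (X X' : C) (f : hom X X'),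
    sm_lunit X' ∘ (idm sm_unit ⊠ f) = f ∘ sm_lunit X;
  sm_runit_nat : forall (X X' : C) (f : hom X X'),
    sm_runit X' ∘ (f ⊠ idm sm_unit) = f ∘ sm_runit X;
  sm_braid_nat : forall (X X' Y Y' : C) (f : hom X X') (g : hom Y Y'),
    sm_braid X' Y' ∘ (f ⊠ g) = (g ⊠ f) ∘ sm_braid X Y;

  sm_pentagon : forall X Y Z W : C,
    (idm X ⊠ sm_assoc Y Z W) ∘ sm_assoc X (Y ⊗ Z) W ∘ (sm_assoc X Y Z ⊠ idm W)
    = sm_assoc X Y (Z ⊗ W) ∘ sm_assoc (X ⊗ Y) Z W;
  sm_triangle : forall X Y : C,
    (idm X ⊠ sm_lunit Y) ∘ sm_assoc X sm_unit Y = sm_runit X ⊠ idm Y;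
  sm_hexagon : forall X Y Z : C,
    sm_assoc Y Z X ∘ sm_braid X (Y ⊗ Z) ∘ sm_assoc X Y Z
    = (idm Y ⊠ sm_braid X Z) ∘ sm_assoc Y X Z ∘ (sm_braid X Y ⊠ idm Z)
}.

Record tensorCategory (k : fieldType) := TensorCategory {
  tc_cat :> linearCategory k;
  tc_additive : is_additive tc_cat;
  tc_mon : symMonoidal tc_cat;
  tc_end_unit : bijective (fun c : k => c *: idm (sm_unit tc_mon))
}.

Definition tunit k (C : tensorCategory k) : C := sm_unit (tc_mon C).
Definition tens k (C : tensorCategory k) : C -> C -> C := sm_tens (tc_mon C).
Arguments tunit {k C}.

Notation "'𝟏'" := tunit : tcat_scope.
Notation "X ⊗ Y" := (tens X Y) : tcat_scope.

Section TensorOps.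
Variables (k : fieldType) (C : tensorCategory k).
Implicit Types X Y Z : C.

Definition tensm X X' Y Y' : hom X X' -> hom Y Y' -> hom (X ⊗ Y) (X' ⊗ Y') :=
  @sm_tensm k C (tc_mon C) X X' Y Y'.
Definition assoc X Y Z : hom ((X ⊗ Y) ⊗ Z) (X ⊗ (Y ⊗ Z)) :=
  sm_assoc (tc_mon C) X Y Z.
Definition associ X Y Z : hom (X ⊗ (Y ⊗ Z)) ((X ⊗ Y) ⊗ Z) :=
  sm_associ (tc_mon C) X Y Z.
Definition lunit X : hom (𝟏 ⊗ X) X := sm_lunit (tc_mon C) X.
Definition luniti X : hom X (𝟏 ⊗ X) := sm_luniti (tc_mon C) X.
Definition runit X : hom (X ⊗ 𝟏) X := sm_runit (tc_mon C) X.
Definition runiti X : hom X (X ⊗ 𝟏) := sm_runiti (tc_mon C) X.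
Definition braid X Y : hom (X ⊗ Y) (Y ⊗ X) := sm_braid (tc_mon C) X Y.
End TensorOps.

Notation "f ⊠ g" := (tensm f g) : tcat_scope.

Definition global_sections k (C : tensorCategory k) (X : C) : lmodType k :=
  hom 𝟏 X.

(* Structure maps without the axioms, so that A ⊗ A and modules over it can be
   written down before the axioms for A ⊗ A are checked. *)
Record algData k (C : tensorCategory k) := AlgData {
  alg_ob :> C;
  alg_mul : hom (alg_ob ⊗ alg_ob) alg_ob;
  alg_one : hom 𝟏 alg_ob
}.

Definition is_algebra k (C : tensorCategory k) (A : algData C) : Prop :=
  [/\ alg_mul A ∘ (alg_mul A ⊠ idm A)
        = alg_mul A ∘ (idm A ⊠ alg_mul A) ∘ assoc A A A,
      alg_mul A ∘ (alg_one A ⊠ idm A) = lunit A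
    & alg_mul A ∘ (idm A ⊠ alg_one A) = runit A].

Record algebra k (C : tensorCategory k) := Algebra {
  alg_data :> algData C;
  algebraP : is_algebra alg_data
}.

Section Constructions.
Variables (k : fieldType) (C : tensorCategory k).

(* (a ⊗ b) ⊗ (c ⊗ d) |-> (a ⊗ c) ⊗ (b ⊗ d) *)
Definition middle_swap (X Y Z W : C) :
    hom ((X ⊗ Y) ⊗ (Z ⊗ W)) ((X ⊗ Z) ⊗ (Y ⊗ W)) :=
  associ X Z (Y ⊗ W)
  ∘ (idm X ⊠ (assoc Z Y W ∘ (braid Y Z ⊠ idm W) ∘ associ Y Z W))
  ∘ assoc X Y (Z ⊗ W).

Definition tens_alg (A B : algData C) : algData C :=
  @AlgData k C (A ⊗ B)
    ((alg_mul A ⊠ alg_mul B) ∘ middle_swap A B A B)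
    ((alg_one A ⊠ alg_one B) ∘ luniti 𝟏).

Definition op_alg (A : algData C) : algData C :=
  @AlgData k C A (alg_mul A ∘ braid A A) (alg_one A).

Definition lmul (B : algData C) (x : global_sections B) : hom B B :=
  alg_mul B ∘ (x ⊠ idm B) ∘ luniti B.

Definition rmul (B : algData C) (x : global_sections B) : hom B B :=
  alg_mul B ∘ (idm B ⊠ x) ∘ runiti B.

Definition is_S_structure (A : algData C)
    (pi : global_sections (tens_alg A A)) (eps : hom A 𝟏) : Prop :=
  braid A A = lmul pi ∘ rmul pi /\
  alg_mul A = runit A ∘ (idm A ⊠ eps) ∘ rmul pi.

Definition admits_S_structure (A : algData C) : Prop :=
  exists (pi : global_sections (tens_alg A A)) (eps : hom A 𝟏),
    is_S_structure pi eps.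

Record dual (X : C) := Dual {
  dual_ob :> C;
  dual_ev : hom (dual_ob ⊗ X) 𝟏;
  dual_coev : hom 𝟏 (X ⊗ dual_ob);
  dual_zig :
    runit X ∘ (idm X ⊠ dual_ev) ∘ assoc X dual_ob X
      ∘ (dual_coev ⊠ idm X) ∘ luniti X = idm X;
  dual_zag :
    lunit dual_ob ∘ (dual_ev ⊠ idm dual_ob) ∘ associ dual_ob X dual_ob
      ∘ (idm dual_ob ⊠ dual_coev) ∘ runiti dual_ob = idm dual_ob
}.

(* (a ⊗ b) ⊗ x |-> a (x b) *)
Definition sandwich (A : algData C) : hom (tens_alg A (op_alg A) ⊗ A) A :=
  alg_mul A ∘ (idm A ⊠ (alg_mul A ∘ braid A A)) ∘ assoc A A A.

(* The map M -> X ⊗ X^* corresponding to f : M ⊗ X -> X under the adjunction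
   given by the dual, X ⊗ X^* being the internal endomorphism object of X. *)
Definition curry_end (M X : C) (D : dual X) (f : hom (M ⊗ X) X) :
    hom M (X ⊗ D) :=
  (f ⊠ idm D) ∘ associ M X D ∘ (idm M ⊠ dual_coev D) ∘ runiti M.

Definition is_azumaya (A : algData C) : Prop :=
  exists D : dual A, is_iso (curry_end D (sandwich A)).

Record bimodData (A : algData C) := BimodData {
  bm_ob :> C;
  bm_lact : hom (A ⊗ bm_ob) bm_ob;
  bm_ract : hom (bm_ob ⊗ A) bm_ob
}.

Record is_bimodule (A : algData C) (M : bimodData A) : Prop := IsBimodule {
  bm_lactA : bm_lact M ∘ (alg_mul A ⊠ idm M)
    = bm_lact M ∘ (idm A ⊠ bm_lact M) ∘ assoc A A M;
  bm_lact1 : bm_lact M ∘ (alg_one A ⊠ idm M) = lunit M;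
  bm_ractA : bm_ract M ∘ (bm_ract M ⊠ idm A)
    = bm_ract M ∘ (idm M ⊠ alg_mul A) ∘ assoc M A A;
  bm_ract1 : bm_ract M ∘ (idm M ⊠ alg_one A) = runit M;
  bm_actC : bm_ract M ∘ (bm_lact M ⊠ idm A)
    = bm_lact M ∘ (idm A ⊠ bm_ract M) ∘ assoc A M A
}.

Record bimodule (A : algData C) := Bimodule {
  bm_data :> bimodData A;
  bimoduleP : is_bimodule bm_data
}.

Definition is_bimod_hom (A : algData C) (M N : bimodData A) : pred (hom M N) :=
  fun f => (f ∘ bm_lact M == bm_lact N ∘ (idm A ⊠ f))
        && (f ∘ bm_ract M == bm_ract N ∘ (f ⊠ idm A)).

Definition bimod_hom (A : algData C) (M N : bimodData A) : Type :=
  {f : hom M N | is_bimod_hom f}.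

Definition regular_bimod (B : algData C) : bimodData B :=
  @BimodData B B (alg_mul B) (alg_mul B).

(* The right action becomes m · b := m t(b). *)
Definition twist_bimod (B : algData C) (t : hom B B) (M : bimodData B) :
    bimodData B :=
  @BimodData B M (bm_lact M) (bm_ract M ∘ (idm M ⊠ t)).

(* The condition that the invariant tilde-eta of A equals 1. *)
Definition eta_trivial (A : algData C) : Prop :=
  let B := tens_alg A A in
  exists i : hom B B,
    [/\ @is_bimod_hom B (regular_bimod B)
          (@twist_bimod B (braid A A) (regular_bimod B)) i,
        is_iso i
      & i ∘ i = idm B].

End Constructions.

Section Coherence.
Variables (k : fieldType) (C : tensorCategory k).
Implicit Types X Y Z W : C.

Lemma tensm_id X Y : idm X ⊠ idm Y = idm (X ⊗ Y).
Proof. exact: sm_tensm_id. Qed.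

Lemma tensm_comp X X' X'' Y Y' Y'' (f' : hom X' X'') (f : hom X X')
    (g' : hom Y' Y'') (g : hom Y Y') :
  (f' ∘ f) ⊠ (g' ∘ g) = (f' ⊠ g') ∘ (f ⊠ g).
Proof. exact: sm_tensm_comp. Qed.

Lemma assocK X Y Z : associ X Y Z ∘ assoc X Y Z = idm _.
Proof. exact: sm_assocK. Qed.
Lemma associK X Y Z : assoc X Y Z ∘ associ X Y Z = idm _.
Proof. exact: sm_associK. Qed.
Lemma braidK X Y : braid Y X ∘ braid X Y = idm _.
Proof. exact: sm_braidK. Qed.

Lemma assoc_nat X X' Y Y' Z Z' (f : hom X X') (g : hom Y Y') (h : hom Z Z') :
  assoc X' Y' Z' ∘ ((f ⊠ g) ⊠ h) = (f ⊠ (g ⊠ h)) ∘ assoc X Y Z.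
Proof. exact: sm_assoc_nat. Qed.
Lemma lunit_nat X X' (f : hom X X') : lunit X' ∘ (idm 𝟏 ⊠ f) = f ∘ lunit X.
Proof. exact: sm_lunit_nat. Qed.
Lemma runit_nat X X' (f : hom X X') : runit X' ∘ (f ⊠ idm 𝟏) = f ∘ runit X.
Proof. exact: sm_runit_nat. Qed.
Lemma braid_nat X X' Y Y' (f : hom X X') (g : hom Y Y') :
  braid X' Y' ∘ (f ⊠ g) = (g ⊠ f) ∘ braid X Y.
Proof. exact: sm_braid_nat. Qed.

Lemma pentagon X Y Z W :
  (idm X ⊠ assoc Y Z W) ∘ assoc X (Y ⊗ Z) W ∘ (assoc X Y Z ⊠ idm W)
  = assoc X Y (Z ⊗ W) ∘ assoc (X ⊗ Y) Z W.
Proof. exact: sm_pentagon. Qed.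
Lemma triangle X Y : (idm X ⊠ lunit Y) ∘ assoc X 𝟏 Y = runit X ⊠ idm Y.
Proof. exact: sm_triangle. Qed.
Lemma hexagon X Y Z :
  assoc Y Z X ∘ braid X (Y ⊗ Z) ∘ assoc X Y Z
  = (idm Y ⊠ braid X Z) ∘ assoc Y X Z ∘ (braid X Y ⊠ idm Z).
Proof. exact: sm_hexagon. Qed.

Lemma comp_post X Y Z W (g : hom Y Z) (f : hom X Y) (r : hom X Z) :
  g ∘ f = r -> forall h : hom Z W, h ∘ g ∘ f = h ∘ r.
Proof. by move=> <- h; rewrite compA. Qed.

Lemma comp_post3 X Y Y' Z W (g : hom Y' Z) (g' : hom Y Y') (f : hom X Y)
    (r : hom X Z) :
  g ∘ g' ∘ f = r -> forall h : hom Z W, h ∘ g ∘ g' ∘ f = h ∘ r.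
Proof. by move=> <- h; rewrite !compA. Qed.

Lemma tensm_compl X X' X'' Y (f : hom X' X'') (g : hom X X') :
  (f ∘ g) ⊠ idm Y = (f ⊠ idm Y) ∘ (g ⊠ idm Y).
Proof. by rewrite -tensm_comp compm1. Qed.

Lemma tensm_compr X Y Y' Y'' (f : hom Y' Y'') (g : hom Y Y') :
  idm X ⊠ (f ∘ g) = (idm X ⊠ f) ∘ (idm X ⊠ g).
Proof. by rewrite -tensm_comp compm1. Qed.

Lemma tensm_exch X X' Y Y' (f : hom X X') (g : hom Y Y') :
  (f ⊠ idm Y') ∘ (idm X ⊠ g) = (idm X' ⊠ g) ∘ (f ⊠ idm Y).
Proof. by rewrite -!tensm_comp !comp1m !compm1. Qed.

Lemma associ_nat X X' Y Y' Z Z' (f : hom X X') (g : hom Y Y') (h : hom Z Z') :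
  associ X' Y' Z' ∘ (f ⊠ (g ⊠ h)) = ((f ⊠ g) ⊠ h) ∘ associ X Y Z.
Proof.
rewrite -[RHS]comp1m -(assocK X' Y' Z') !compA.
by rewrite (comp_post (assoc_nat _ _ _)) !compA (comp_post (associK _ _ _)) compm1.
Qed.

Lemma tensm1_inj X Y (f g : hom X Y) : f ⊠ idm 𝟏 = g ⊠ idm 𝟏 -> f = g.
Proof.
move=> /(congr1 (fun h => runit Y ∘ h ∘ runiti X)).
by rewrite !runit_nat -!compA sm_runitiK !compm1.
Qed.

Lemma tens1m_inj X Y (f g : hom X Y) : idm 𝟏 ⊠ f = idm 𝟏 ⊠ g -> f = g.
Proof.
move=> /(congr1 (fun h => lunit Y ∘ h ∘ luniti X)).
by rewrite !lunit_nat -!compA sm_lunitiK !compm1.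
Qed.

Lemma assoc_linj W X Y Z (f g : hom W ((X ⊗ Y) ⊗ Z)) :
  assoc X Y Z ∘ f = assoc X Y Z ∘ g -> f = g.
Proof.
move=> /(congr1 (fun h => associ X Y Z ∘ h)).
by rewrite !compA assocK !comp1m.
Qed.

Lemma assoc_rinj W X Y Z (f g : hom (X ⊗ (Y ⊗ Z)) W) :
  f ∘ assoc X Y Z = g ∘ assoc X Y Z -> f = g.
Proof.
move=> /(congr1 (fun h => h ∘ associ X Y Z)).
by rewrite -!compA associK !compm1.
Qed.

Lemma assoc_tens1_rinj W X Y Z V (f g : hom ((X ⊗ (Y ⊗ Z)) ⊗ V) W) :
  f ∘ (assoc X Y Z ⊠ idm V) = g ∘ (assoc X Y Z ⊠ idm V) -> f = g.
Proof.
move=> /(congr1 (fun h => h ∘ (associ X Y Z ⊠ idm V))).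
by rewrite -!compA -tensm_compl associK tensm_id !compm1.
Qed.

Lemma runit_tens X Y : (idm X ⊠ runit Y) ∘ assoc X Y 𝟏 = runit (X ⊗ Y).
Proof.
apply: tensm1_inj; apply: assoc_linj.
rewrite tensm_compl compA assoc_nat -(triangle Y) tensm_compr.
rewrite ?compA (comp_post3 (pentagon _ _ _ _)) ?compA.
by rewrite -(triangle (X ⊗ Y)) -tensm_id compA assoc_nat.
Qed.

Lemma lunit_tens X Y : lunit (X ⊗ Y) ∘ assoc 𝟏 X Y = lunit X ⊠ idm Y.
Proof.
apply: tens1m_inj; apply: assoc_rinj; apply: assoc_tens1_rinj.
rewrite tensm_compr ?compA (comp_post3 (pentagon _ _ _ _)) ?compA.
rewrite triangle -tensm_id -assoc_nat -assoc_nat.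
by rewrite -[RHS]compA -tensm_compl triangle.
Qed.

Lemma runit_braid X : runit X ∘ braid 𝟏 X = lunit X.
Proof.
suff H Y : runit Y = lunit Y ∘ braid Y 𝟏 by rewrite H -compA braidK compm1.
apply: tensm1_inj.
have /(congr1 (fun h => braid 𝟏 Y ∘ (lunit (𝟏 ⊗ Y) ∘ h))) := hexagon Y 𝟏 𝟏.
rewrite ?compA !(comp_post (lunit_tens _ _)).
rewrite (comp_post (esym (braid_nat _ _))) ?compA braidK comp1m triangle => ->.
rewrite (comp_post (lunit_nat _)) ?compA braidK comp1m.
by rewrite lunit_tens -tensm_compl.
Qed.

Lemma pentagon_l X Y Z W :
  associ X Y (Z ⊗ W) ∘ (idm X ⊠ assoc Y Z W)
  = assoc (X ⊗ Y) Z W ∘ (associ X Y Z ⊠ idm W) ∘ associ X (Y ⊗ Z) W.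
Proof.
apply: assoc_rinj; apply: assoc_tens1_rinj.
rewrite (comp_post3 (pentagon _ _ _ _)) ?compA assocK comp1m.
rewrite (comp_post (assocK _ _ _)) compm1.
by rewrite -compA -tensm_compl assocK tensm_id compm1.
Qed.

Lemma pentagon_r X Y Z W :
  associ X (Y ⊗ Z) W ∘ (idm X ⊠ associ Y Z W) ∘ assoc X Y (Z ⊗ W)
  = (assoc X Y Z ⊠ idm W) ∘ associ (X ⊗ Y) Z W.
Proof.
apply: assoc_rinj; rewrite (comp_post (assocK _ _ _)) compm1.
rewrite -compA -pentagon ?compA.
rewrite (comp_post (esym (tensm_compr _ _ _))) assocK tensm_id compm1.
by rewrite assocK comp1m.
Qed.

Lemma braid_tensl X Y Z :
  braid (X ⊗ Y) Z = assoc Z X Y ∘ (braid X Z ⊠ idm Y) ∘ associ X Z Y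
                    ∘ (idm X ⊠ braid Y Z) ∘ assoc X Y Z.
Proof.
have E : braid (X ⊗ Y) Z ∘ associ X Y Z ∘
    (assoc X Y Z ∘ braid Z (X ⊗ Y) ∘ assoc Z X Y) = assoc Z X Y.
  by rewrite ?compA (comp_post (assocK _ _ _)) compm1 braidK comp1m.
rewrite -[in RHS]E hexagon ?compA.
rewrite (comp_post (esym (tensm_compl _ _ _))) braidK tensm_id compm1.
rewrite (comp_post (associK _ _ _)) compm1.
rewrite (comp_post (esym (tensm_compr _ _ _))) braidK tensm_id compm1.
by rewrite (comp_post (assocK _ _ _)) compm1.
Qed.

End Coherence.

Section BimoduleCategory.
Variables (k : fieldType) (C : tensorCategory k) (A : algData C).

Fact bimod_id_subproof (M : bimodule A) :
  is_bimod_hom (M := M) (N := M) (idm M).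
Proof. by rewrite /is_bimod_hom !tensm_id !comp1m !compm1 !eqxx. Qed.

Fact bimod_comp_subproof (M N P : bimodule A) (g : bimod_hom N P)
    (f : bimod_hom M N) :
  is_bimod_hom (M := M) (N := P) (val g ∘ val f).
Proof.
case: g f => [g /= /andP[/eqP gl /eqP gr]] [f /= /andP[/eqP fl /eqP fr]].
apply/andP; split; apply/eqP.
  by rewrite -compA fl compA gl tensm_compr -compA.
by rewrite -compA fr compA gr tensm_compl -compA.
Qed.

Definition bimod_id (M : bimodule A) : bimod_hom M M :=
  exist _ (idm (M : C)) (bimod_id_subproof M).

Definition bimod_comp (M N P : bimodule A) (g : bimod_hom N P)
    (f : bimod_hom M N) : bimod_hom M P :=
  exist _ (val g ∘ val f) (bimod_comp_subproof g f).

Fact bimod_comp1m (M N : bimodule A) (f : bimod_hom M N) :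
  bimod_comp (bimod_id N) f = f.
Proof. by apply: val_inj; rewrite /= comp1m. Qed.

Fact bimod_compm1 (M N : bimodule A) (f : bimod_hom M N) :
  bimod_comp f (bimod_id M) = f.
Proof. by apply: val_inj; rewrite /= compm1. Qed.

Fact bimod_compA (M N P Q : bimodule A) (h : bimod_hom P Q)
    (g : bimod_hom N P) (f : bimod_hom M N) :
  bimod_comp h (bimod_comp g f) = bimod_comp (bimod_comp h g) f.
Proof. by apply: val_inj; rewrite /= compA. Qed.

Definition bimod_category : category :=
  @Category (bimodule A) (fun M N => bimod_hom M N) bimod_id bimod_comp
    bimod_comp1m bimod_compm1 bimod_compA.

End BimoduleCategory.

Section FreeBimodule.
Variables (k : fieldType) (C : tensorCategory k) (A : algebra C).

(* b (x ⊗ a) = x ⊗ b a  and  (x ⊗ a) b = x ⊗ a b *)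
Definition tens_bimod_ract (X : C) : hom ((X ⊗ A) ⊗ A) (X ⊗ A) :=
  (idm X ⊠ alg_mul A) ∘ assoc X A A.

Definition tens_bimod_lact (X : C) : hom (A ⊗ (X ⊗ A)) (X ⊗ A) :=
  (idm X ⊠ alg_mul A) ∘ assoc X A A ∘ (braid A X ⊠ idm A) ∘ associ A X A.

Lemma tens_bimod_ractA (X : C) :
  tens_bimod_ract X ∘ (tens_bimod_ract X ⊠ idm A)
  = tens_bimod_ract X ∘ (idm (X ⊗ A) ⊠ alg_mul A) ∘ assoc (X ⊗ A) A A.
Proof.
have [mulA _ _] := algebraP A.
rewrite /tens_bimod_ract tensm_compl ?compA.
rewrite (comp_post (assoc_nat _ _ _)) ?compA -tensm_compr mulA !tensm_compr.
rewrite (comp_post3 (pentagon _ _ _ _)) ?compA -tensm_id.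
by rewrite (comp_post (assoc_nat _ _ _)) ?compA.
Qed.

Lemma tens_bimod_ract1 (X : C) :
  tens_bimod_ract X ∘ (idm (X ⊗ A) ⊠ alg_one A) = runit (X ⊗ A).
Proof.
have [_ _ mul1r] := algebraP A.
rewrite /tens_bimod_ract -tensm_id (comp_post (assoc_nat _ _ _)) ?compA.
by rewrite -tensm_compr mul1r runit_tens.
Qed.

Lemma tens_bimod_lact1 (X : C) :
  tens_bimod_lact X ∘ (alg_one A ⊠ idm (X ⊗ A)) = lunit (X ⊗ A).
Proof.
have [_ mul1l _] := algebraP A.
rewrite /tens_bimod_lact -tensm_id (comp_post (associ_nat _ _ _)) ?compA.
rewrite (comp_post (esym (tensm_compl _ _ _))) braid_nat tensm_compl ?compA.
rewrite (comp_post (assoc_nat _ _ _)) ?compA -tensm_compr mul1l triangle.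
by rewrite -tensm_compl runit_braid -lunit_tens (comp_post (associK _ _ _)) compm1.
Qed.

Lemma tens_bimod_actC (X : C) :
  tens_bimod_ract X ∘ (tens_bimod_lact X ⊠ idm A)
  = tens_bimod_lact X ∘ (idm A ⊠ tens_bimod_ract X) ∘ assoc A (X ⊗ A) A.
Proof.
have -> : tens_bimod_lact X
    = tens_bimod_ract X ∘ (braid A X ⊠ idm A) ∘ associ A X A by [].
rewrite 2!tensm_compl ?compA tens_bimod_ractA.
rewrite (comp_post (assoc_nat _ _ _)) ?compA tensm_id.
rewrite (comp_post (esym (tensm_exch _ _))) ?compA.
rewrite [in RHS]/tens_bimod_ract tensm_compr ?compA.
rewrite (comp_post (associ_nat _ _ _)) tensm_id ?compA.
rewrite (comp_post (pentagon_l _ _ _ _)) ?compA.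
by rewrite (comp_post (assocK _ _ _)) compm1.
Qed.

Lemma tens_bimod_lactA (X : C) :
  tens_bimod_lact X ∘ (alg_mul A ⊠ idm (X ⊗ A))
  = tens_bimod_lact X ∘ (idm A ⊠ tens_bimod_lact X) ∘ assoc A A (X ⊗ A).
Proof.
have [mulA _ _] := algebraP A.
rewrite /tens_bimod_lact !tensm_compr ?compA.
rewrite -[in LHS]tensm_id (comp_post (associ_nat _ _ _)) ?compA.
rewrite (comp_post (esym (tensm_compl _ _ _))) braid_nat tensm_compl ?compA.
rewrite (comp_post (assoc_nat _ _ _)) ?compA -tensm_compr mulA !tensm_compr.
rewrite braid_tensl !tensm_compl ?compA.
rewrite (comp_post3 (pentagon _ _ _ _)) ?compA.
rewrite (comp_post (assoc_nat _ _ _)) tensm_id ?compA.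
rewrite [in RHS](comp_post (associ_nat _ _ _)) tensm_id ?compA.
rewrite [in RHS](comp_post (tensm_exch _ _)) ?compA.
rewrite -[in RHS]tensm_id [in RHS](comp_post (assoc_nat _ _ _)) ?compA.
rewrite (comp_post (pentagon_l _ _ _ _)) ?compA.
rewrite (comp_post (associ_nat _ _ _)) ?compA.
by rewrite (comp_post3 (pentagon_r _ _ _ _)) ?compA.
Qed.

Definition tens_bimod_data (X : C) : bimodData A :=
  @BimodData k C A (X ⊗ A) (tens_bimod_lact X) (tens_bimod_ract X).

Fact tens_bimodP (X : C) : is_bimodule (tens_bimod_data X).
Proof.
split; [exact: tens_bimod_lactA | exact: tens_bimod_lact1
  | exact: tens_bimod_ractA | exact: tens_bimod_ract1 | exact: tens_bimod_actC].
Qed.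

Definition tens_bimod (X : C) : bimodule A := Bimodule (tens_bimodP X).

Fact tens_bimod_hom_subproof (X Y : C) (f : hom X Y) :
  is_bimod_hom (M := tens_bimod X) (N := tens_bimod Y) (f ⊠ idm A).
Proof.
have natr : (f ⊠ idm A) ∘ tens_bimod_ract X
    = tens_bimod_ract Y ∘ ((f ⊠ idm A) ⊠ idm A).
  rewrite /tens_bimod_ract ?compA tensm_exch.
  by rewrite (comp_post (assoc_nat _ _ _)) tensm_id ?compA.
apply/andP; split; apply/eqP; last exact: natr.
change ((f ⊠ idm A) ∘ (tens_bimod_ract X ∘ (braid A X ⊠ idm A) ∘ associ A X A)
  = tens_bimod_ract Y ∘ (braid A Y ⊠ idm A) ∘ associ A Y A
    ∘ (idm A ⊠ (f ⊠ idm A))).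
rewrite 2!compA natr (comp_post (associ_nat _ _ _)) ?compA.
rewrite !(comp_post (esym (tensm_compl _ _ _))).
by rewrite braid_nat.
Qed.

Definition tens_bimod_hom (X Y : C) (f : hom X Y) :
    bimod_hom (tens_bimod X) (tens_bimod Y) :=
  exist _ (f ⊠ idm A) (tens_bimod_hom_subproof f).

Fact tens_bimod_id (X : C) : tens_bimod_hom (idm X) = bimod_id (tens_bimod X).
Proof. by apply: val_inj; rewrite /= tensm_id. Qed.

Fact tens_bimod_comp (X Y Z : C) (g : hom Y Z) (f : hom X Y) :
  tens_bimod_hom (g ∘ f) = bimod_comp (tens_bimod_hom g) (tens_bimod_hom f).
Proof. by apply: val_inj; rewrite /= tensm_compl. Qed.

Definition tens_bimod_functor : functor (underlying C) (bimod_category A) :=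
  @Functor (underlying C) (bimod_category A) tens_bimod tens_bimod_hom
    tens_bimod_id tens_bimod_comp.

End FreeBimodule.

(* Main.v *)
From mathcomp Require Import all_boot all_algebra.
Require Import Defs.

Set Implicit Arguments.
Unset Strict Implicit.
Unset Printing Implicit Defensive.

Import GRing.Theory.
Local Open Scope ring_scope.
Local Open Scope tcat_scope.

(** Write pi = p ⊗ q (a sum) and tau(x) = pi x pi in B = A ⊗ A. As tau(1) = 1,
    pi^2 = 1, so pi (b ⊗ 1) = (1 ⊗ b) pi and pi (1 ⊗ b) = (b ⊗ 1) pi, that is
    p ⊗ bq = pb ⊗ q and bp ⊗ q = p ⊗ qb.

    (b) Right multiplication by pi is a B-bimodule map B -> B^† of square 1.
    The object A is its own dual with coevaluation pi and evaluation
    eps ∘ mul, and then A ⊗ A^op -> A ⊗ A^* sends a ⊗ b to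
    a p b ⊗ q = ap ⊗ bq, so it is right multiplication by pi, an involution.

    (a) Given i : B -> B^†, put u = i(1) = p ⊗ q. Then i is right
    multiplication by u, u^2 = 1 and tau(x) = u x u. The two identities above hold
    for u and show that b ↦ p b q has central values, so a ⊗ b ↦ a p b q is an
    A-bimodule map with b as a parameter. Fullness of X ↦ X ⊗ A makes it
    a ⊗ b ↦ a eps(b) for some eps : A -> 𝟏, and u^2 = 1 turns this into
    mul = (id ⊗ eps) ρ_u. *)

(** * Unit isomorphisms *)

Section Units.
Variables (k : fieldType) (C : tensorCategory k).
Implicit Types X Y Z W : C.

Lemma lunitK X : luniti X ∘ lunit X = idm _.
Proof. exact: sm_lunitK. Qed.
Lemma lunitiK X : lunit X ∘ luniti X = idm _.
Proof. exact: sm_lunitiK. Qed.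
Lemma runitiK X : runit X ∘ runiti X = idm _.
Proof. exact: sm_runitiK. Qed.

Lemma luniti_nat X Y (f : hom X Y) : luniti Y ∘ f = (idm 𝟏 ⊠ f) ∘ luniti X.
Proof.
rewrite -[LHS]compm1 -(lunitiK X) !compA (comp_post (esym (lunit_nat _))).
by rewrite !compA lunitK comp1m.
Qed.

Lemma lunit_braid X : lunit X ∘ braid X 𝟏 = runit X.
Proof. by rewrite -runit_braid -compA braidK compm1. Qed.

End Units.

(** * Strictification: tensor words acting on a variable object *)

Section Flat.
Variables (k : fieldType) (C : tensorCategory k).

(* A morphism f : S -> T between tensor words gives the family
   [flat f W : act S W -> act T W], where [act (X1 ⊗ ... ⊗ Xn) W] is
   X1 ⊗ (X2 ⊗ (... ⊗ (Xn ⊗ W))) whatever the bracketing of the word and its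
   units. All coherence isomorphisms become identities, tensoring with idm on the
   right becomes a change of W, and f is recovered from W = 𝟏. *)
Inductive shape := Atom of C | Unit | Tens of shape & shape.

Fixpoint obj (T : shape) : C :=
  match T with Atom X => X | Unit => 𝟏 | Tens T U => obj T ⊗ obj U end.

Fixpoint act (T : shape) (W : C) : C :=
  match T with Atom X => X ⊗ W | Unit => W | Tens T U => act T (act U W) end.

Fixpoint actm (T : shape) (W W' : C) (f : hom W W') : hom (act T W) (act T W') :=
  match T with
  | Atom X => idm X ⊠ f
  | Unit => f
  | Tens T U => actm T (actm U f)
  end.

Fixpoint coh (T : shape) (W : C) : hom (obj T ⊗ W) (act T W) :=
  match T with
  | Atom X => idm _
  | Unit => lunit W
  | Tens T U => coh T (act U W) ∘ (idm (obj T) ⊠ coh U W) ∘ assoc (obj T) (obj U) W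
  end.

Fixpoint cohi (T : shape) (W : C) : hom (act T W) (obj T ⊗ W) :=
  match T with
  | Atom X => idm _
  | Unit => luniti W
  | Tens T U =>
      associ (obj T) (obj U) W ∘ (idm (obj T) ⊠ cohi U W) ∘ cohi T (act U W)
  end.

Lemma cohK T W : cohi T W ∘ coh T W = idm _.
Proof.
elim: T W => [X|| S IS T IT] W /=; first by rewrite comp1m.
  exact: lunitK.
rewrite !compA (comp_post (IS _)) compm1.
by rewrite (comp_post (esym (tensm_compr _ _ _))) IT tensm_id compm1 assocK.
Qed.

Lemma cohiK T W : coh T W ∘ cohi T W = idm _.
Proof.
elim: T W => [X|| S IS T IT] W /=; first by rewrite comp1m.
  exact: lunitiK.
rewrite !compA (comp_post (associK _ _ _)) compm1.
by rewrite (comp_post (esym (tensm_compr _ _ _))) IT tensm_id compm1 IS.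
Qed.

Lemma coh_nat T W W' (f : hom W W') :
  coh T W' ∘ (idm (obj T) ⊠ f) = actm T f ∘ coh T W.
Proof.
elim: T W W' f => [X|| S IS T IT] W W' f /=; first by rewrite comp1m compm1.
  exact: lunit_nat.
rewrite -tensm_id (comp_post (assoc_nat _ _ _)) !compA.
by rewrite (comp_post (esym (tensm_compr _ _ _))) IT tensm_compr !compA IS.
Qed.

Lemma cohi_nat T W W' (f : hom W W') :
  cohi T W' ∘ actm T f = (idm (obj T) ⊠ f) ∘ cohi T W.
Proof.
rewrite -[LHS]compm1 -(cohiK T W) !compA (comp_post (esym (coh_nat _ _))).
by rewrite !compA cohK comp1m.
Qed.

(* Locked: otherwise unification unfolds it when looking for a composite. *)
Fact flat_key : unit. Proof. exact: tt. Qed.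
Definition flat (S T : shape) (f : hom (obj S) (obj T)) (W : C) :
    hom (act S W) (act T W) :=
  locked_with flat_key (coh T W ∘ (f ⊠ idm W) ∘ cohi S W).

Lemma flatE S T (f : hom (obj S) (obj T)) W :
  flat f W = coh T W ∘ (f ⊠ idm W) ∘ cohi S W.
Proof. by rewrite /flat unlock. Qed.

Lemma flat_inj S T (f g : hom (obj S) (obj T)) :
  (forall W, flat f W = flat g W) -> f = g.
Proof.
move=> /(_ 𝟏); rewrite !flatE => /(congr1 (fun h => cohi T _ ∘ h ∘ coh S _)).
rewrite !compA !cohK !comp1m !(comp_post (cohK _ _)) !compm1.
exact: tensm1_inj.
Qed.

Lemma flat_nat S T (f : hom (obj S) (obj T)) W W' (h : hom W W') :
  flat f W' ∘ actm S h = actm T h ∘ flat f W.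
Proof.
rewrite !flatE (comp_post (cohi_nat _ _)) !compA.
by rewrite (comp_post (tensm_exch _ _)) !compA coh_nat.
Qed.

Lemma flat_id S W : flat (S := S) (T := S) (idm (obj S)) W = idm _.
Proof. by rewrite !flatE tensm_id compm1 cohiK. Qed.

Lemma flat_comp S T U (g : hom (obj T) (obj U)) (f : hom (obj S) (obj T)) W :
  flat (S := S) (T := U) (g ∘ f) W = flat g W ∘ flat f W.
Proof.
rewrite !flatE !compA (comp_post (cohK _ _)) compm1.
by rewrite tensm_compl !compA.
Qed.

(** Bifunctoriality splits [f ⊠ g] into [g] on the inner word followed by [f] on the outer one. *)
Lemma flat_tens S S' T T' (f : hom (obj S) (obj S')) (g : hom (obj T) (obj T')) W :
  flat (S := Tens S T) (T := Tens S' T') (f ⊠ g) W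
  = flat f (act T' W) ∘ actm S (flat g W).
Proof.
rewrite !flatE /= !compA.
rewrite (comp_post (assoc_nat _ _ _)) !compA (comp_post (associK _ _ _)) compm1.
rewrite (comp_post (cohi_nat _ _)) !tensm_compr !compA.
congr (_ ∘ _ ∘ _); rewrite -!compA; congr (_ ∘ _).
by rewrite -!tensm_comp !comp1m !compm1.
Qed.

(** Both bracketings have the same [act], and the pentagon identifies their two maps [coh]. *)
Lemma flat_assoc S T U W :
  flat (S := Tens (Tens S T) U) (T := Tens S (Tens T U))
    (assoc (obj S) (obj T) (obj U)) W = idm _.
Proof.
rewrite !flatE /= !tensm_compr !compA.
rewrite (comp_post3 (pentagon _ _ _ _)) !compA (comp_post (associK _ _ _)) compm1.
rewrite -tensm_id (comp_post (assoc_nat _ _ _)) !compA.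
rewrite (comp_post (associK _ _ _)) compm1.
rewrite !(comp_post (esym (tensm_compr _ _ _))) !compA.
rewrite (comp_post (esym (tensm_compr _ _ _))) cohiK tensm_id compm1.
by rewrite cohiK tensm_id compm1 cohiK.
Qed.

Lemma flat_associ S T U W :
  flat (S := Tens S (Tens T U)) (T := Tens (Tens S T) U)
    (associ (obj S) (obj T) (obj U)) W = idm _.
Proof.
have := @flat_comp (Tens S (Tens T U)) (Tens (Tens S T) U) (Tens S (Tens T U))
  (assoc _ _ _) (associ _ _ _) W.
by rewrite flat_assoc comp1m => <-; rewrite associK flat_id.
Qed.

Lemma flat_lunit S W : flat (S := Tens Unit S) (T := S) (lunit (obj S)) W = idm _.
Proof.
rewrite !flatE /= -lunit_tens !compA (comp_post (associK _ _ _)) compm1.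
rewrite (comp_post (lunit_nat _)) !compA cohiK comp1m.
by rewrite lunitiK.
Qed.

Lemma flat_luniti S W : flat (S := S) (T := Tens Unit S) (luniti (obj S)) W = idm _.
Proof.
have := @flat_comp S (Tens Unit S) S (lunit _) (luniti _) W.
by rewrite flat_lunit comp1m => <-; rewrite lunitiK flat_id.
Qed.

Lemma flat_runit S W : flat (S := Tens S Unit) (T := S) (runit (obj S)) W = idm _.
Proof.
rewrite !flatE /= -triangle !compA (comp_post (associK _ _ _)) compm1.
by rewrite (comp_post (esym (tensm_compr _ _ _))) lunitiK tensm_id compm1 cohiK.
Qed.

Lemma flat_runiti S W : flat (S := S) (T := Tens S Unit) (runiti (obj S)) W = idm _.
Proof.
have := @flat_comp S (Tens S Unit) S (runit _) (runiti _) W.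
by rewrite flat_runit comp1m => <-; rewrite runitiK flat_id.
Qed.

End Flat.
Arguments Unit {k C}.
Arguments flat {k C} S T f W.

(** Unification does not recover a shape from its image under [obj], so the shape is read off the
    syntax of the object and passed explicitly. *)
Ltac shape_of X :=
  lazymatch X with
  | ?Y ⊗ ?Z => let S := shape_of Y in let T := shape_of Z in constr:(Tens S T)
  | @tunit ?k ?C => constr:(@Unit k C)
  | _ => constr:(Atom X)
  end.

Ltac flat_step :=
  match goal with
  | |- context [@flat _ _ ?S ?T (@comp _ _ _ ?Y _ ?g ?f) ?W] =>
      let U := shape_of Y in rewrite (@flat_comp _ _ S U T g f W)
  | |- context [@flat _ _ _ _ (@tensm _ _ ?X ?X' ?Y ?Y' ?f ?g) ?W] =>
      let S := shape_of X in let S' := shape_of X' in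
      let T := shape_of Y in let T' := shape_of Y' in
      rewrite (@flat_tens _ _ S S' T T' f g W)
  | |- context [@flat _ _ _ _ (idm ?X) ?W] =>
      let S := shape_of X in rewrite (@flat_id _ _ S W)
  | |- context [@flat _ _ _ _ (assoc ?X ?Y ?Z) ?W] =>
      let S := shape_of X in let T := shape_of Y in let U := shape_of Z in
      rewrite (@flat_assoc _ _ S T U W)
  | |- context [@flat _ _ _ _ (associ ?X ?Y ?Z) ?W] =>
      let S := shape_of X in let T := shape_of Y in let U := shape_of Z in
      rewrite (@flat_associ _ _ S T U W)
  | |- context [@flat _ _ _ _ (lunit ?X) ?W] =>
      let S := shape_of X in rewrite (@flat_lunit _ _ S W)
  | |- context [@flat _ _ _ _ (luniti ?X) ?W] =>
      let S := shape_of X in rewrite (@flat_luniti _ _ S W)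
  | |- context [@flat _ _ _ _ (runit ?X) ?W] =>
      let S := shape_of X in rewrite (@flat_runit _ _ S W)
  | |- context [@flat _ _ _ _ (runiti ?X) ?W] =>
      let S := shape_of X in rewrite (@flat_runiti _ _ S W)
  end.

Ltac flat_norm :=
  repeat flat_step; cbn [act actm obj];
  rewrite ?tensm_id ?comp1m ?compm1 ?tensm_compr ?compA.

Ltac flatten :=
  lazymatch goal with
  | |- @eq _ ?f ?g =>
    lazymatch type of f with
    | context [@hom _ _ ?X ?Y] =>
      let S := shape_of X in let T := shape_of Y in
      apply: (@flat_inj _ _ S T f g) => ?; flat_norm
    end
  end.

(** * Whiskered generators: products, braidings, sections and forms *)

Section Whiskering.
Variables (k : fieldType) (C : tensorCategory k).
Implicit Types X Y Z W : C.

(** Together with [comp_post], this rewrites two adjacent factors lying under a common [idm X]. *)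
Lemma whisker X Y Y' Z (g : hom Y' Z) (f : hom Y Y') (r : hom Y Z) :
  g ∘ f = r -> (idm X ⊠ g) ∘ (idm X ⊠ f) = idm X ⊠ r.
Proof. by move=> <-; rewrite tensm_compr. Qed.

End Whiskering.

Section Generators.
Variables (k : fieldType) (C : tensorCategory k).
Implicit Types (X Y Z W : C) (A : algData C).

Definition flat_mul A W : hom (A ⊗ (A ⊗ W)) (A ⊗ W) :=
  flat (Tens (Atom A) (Atom A)) (Atom (alg_ob A)) (alg_mul A) W.
Definition flat_braid X Y W : hom (X ⊗ (Y ⊗ W)) (Y ⊗ (X ⊗ W)) :=
  flat (Tens (Atom X) (Atom Y)) (Tens (Atom Y) (Atom X)) (braid X Y) W.
Definition flat_sec X (x : hom 𝟏 X) W : hom W (X ⊗ W) := flat Unit (Atom X) x W.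
Definition flat_sec2 X Y (x : hom 𝟏 (X ⊗ Y)) W : hom W (X ⊗ (Y ⊗ W)) :=
  flat Unit (Tens (Atom X) (Atom Y)) x W.
Definition flat_form X (e : hom X 𝟏) W : hom (X ⊗ W) W := flat (Atom X) Unit e W.

Lemma flat_mul_nat A W W' (f : hom W W') :
  flat_mul A W' ∘ (idm A ⊠ (idm A ⊠ f)) = (idm A ⊠ f) ∘ flat_mul A W.
Proof. exact: (@flat_nat _ _ (Tens (Atom A) (Atom A)) (Atom A)). Qed.

Lemma flat_braid_nat X Y W W' (f : hom W W') :
  flat_braid X Y W' ∘ (idm X ⊠ (idm Y ⊠ f))
  = (idm Y ⊠ (idm X ⊠ f)) ∘ flat_braid X Y W.
Proof.
exact: (@flat_nat _ _ (Tens (Atom X) (Atom Y)) (Tens (Atom Y) (Atom X))).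
Qed.

Lemma flat_sec_nat X (x : hom 𝟏 X) W W' (f : hom W W') :
  flat_sec x W' ∘ f = (idm X ⊠ f) ∘ flat_sec x W.
Proof. exact: (@flat_nat _ _ Unit (Atom X)). Qed.

Lemma flat_sec2_nat X Y (x : hom 𝟏 (X ⊗ Y)) W W' (f : hom W W') :
  flat_sec2 x W' ∘ f = (idm X ⊠ (idm Y ⊠ f)) ∘ flat_sec2 x W.
Proof. exact: (@flat_nat _ _ Unit (Tens (Atom X) (Atom Y))). Qed.

End Generators.

Ltac flat_fold :=
  repeat match goal with
  | |- context [@flat ?k ?C ?S ?T (@alg_mul _ _ ?A) ?W] =>
      change (@flat k C S T (@alg_mul k C A) W) with (flat_mul A W)
  | |- context [@flat ?k ?C (Tens (Atom ?X) (Atom ?Y)) ?T (@braid _ _ ?X ?Y) ?W] =>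
      change (@flat k C (Tens (Atom X) (Atom Y)) T (@braid k C X Y) W)
        with (flat_braid X Y W)
  | |- context [@flat ?k ?C Unit (Atom ?X) ?x ?W] =>
      change (@flat k C Unit (Atom X) x W) with (flat_sec x W)
  | |- context [@flat ?k ?C Unit (Tens (Atom ?X) (Atom ?Y)) ?x ?W] =>
      change (@flat k C Unit (Tens (Atom X) (Atom Y)) x W) with (flat_sec2 x W)
  | |- context [@flat ?k ?C (Atom ?X) Unit ?e ?W] =>
      change (@flat k C (Atom X) Unit e W) with (flat_form e W)
  end.

(** Brings a known equation, such as a coherence axiom, into its strict form at [W], where
    associators and unit isomorphisms have disappeared. *)
Ltac flatten_in H W :=
  lazymatch type of H with
  | @eq _ ?f ?g =>
    lazymatch type of f with
    | context [@hom _ _ ?X ?Y] =>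
      let S := shape_of X in let T := shape_of Y in
      let H' := fresh in
      have H' : flat S T f W = flat S T g W by [congr (flat S T _ W); exact: H];
      move: H'; flat_norm; flat_fold
    end
  end.

(** * Braiding past products, sections and forms *)

Section Braiding.
Variables (k : fieldType) (C : tensorCategory k).
Implicit Types (X Y Z W : C) (A : algData C).

Lemma flat_braidK X Y W : flat_braid Y X W ∘ flat_braid X Y W = idm _.
Proof. have E := braidK X Y. by flatten_in E W. Qed.

(** The hexagon, once its associators have become identities. *)
Lemma flat_braid_tensr X Y Z W :
  flat (Tens (Atom X) (Tens (Atom Y) (Atom Z))) (Tens (Tens (Atom Y) (Atom Z)) (Atom X))
    (braid X (Y ⊗ Z)) W
  = (idm Y ⊠ flat_braid X Z W) ∘ flat_braid X Y (Z ⊗ W).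
Proof. have E := hexagon X Y Z. by flatten_in E W. Qed.

Lemma flat_braid_tensl X Y Z W :
  flat (Tens (Tens (Atom X) (Atom Y)) (Atom Z)) (Tens (Atom Z) (Tens (Atom X) (Atom Y)))
    (braid (X ⊗ Y) Z) W
  = flat_braid X Z (Y ⊗ W) ∘ (idm X ⊠ flat_braid Y Z W).
Proof. have E := braid_tensl X Y Z. by flatten_in E W. Qed.

Lemma flat_braid_unitl X W :
  flat (Tens Unit (Atom X)) (Tens (Atom X) Unit) (braid 𝟏 X) W = idm _.
Proof. have E := runit_braid X. by flatten_in E W. Qed.

Lemma flat_braid_unitr X W :
  flat (Tens (Atom X) Unit) (Tens Unit (Atom X)) (braid X 𝟏) W = idm _.
Proof. have E := braidK 𝟏 X. flatten_in E W. by rewrite flat_braid_unitl compm1. Qed.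

Lemma flat_braid_mulr X A W :
  flat_braid X A W ∘ (idm X ⊠ flat_mul A W)
  = flat_mul A (X ⊗ W) ∘ (idm A ⊠ flat_braid X A W) ∘ flat_braid X A (A ⊗ W).
Proof.
have E := braid_nat (idm X) (alg_mul A). flatten_in E W.
by rewrite flat_braid_tensr compA.
Qed.

Lemma flat_braid_mull X A W :
  flat_braid A X W ∘ flat_mul A (X ⊗ W)
  = (idm X ⊠ flat_mul A W) ∘ flat_braid A X (A ⊗ W) ∘ (idm A ⊠ flat_braid A X W).
Proof.
have E := braid_nat (alg_mul A) (idm X). flatten_in E W.
by rewrite flat_braid_tensl compA.
Qed.

Lemma flat_braid_secr X Y (x : hom 𝟏 Y) W :
  flat_braid X Y W ∘ (idm X ⊠ flat_sec x W) = flat_sec x (X ⊗ W).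
Proof.
have E := braid_nat (idm X) x. flatten_in E W.
by rewrite flat_braid_unitr compm1.
Qed.

Lemma flat_braid_secl X Y (x : hom 𝟏 Y) W :
  flat_braid Y X W ∘ flat_sec x (X ⊗ W) = idm X ⊠ flat_sec x W.
Proof. by rewrite -flat_braid_secr compA flat_braidK comp1m. Qed.

Lemma flat_braid_sec2r X Y Z (x : hom 𝟏 (Y ⊗ Z)) W :
  (idm Y ⊠ flat_braid X Z W) ∘ flat_braid X Y (Z ⊗ W) ∘ (idm X ⊠ flat_sec2 x W)
  = flat_sec2 x (X ⊗ W).
Proof.
have E := braid_nat (idm X) x. flatten_in E W.
by rewrite flat_braid_tensr flat_braid_unitr compm1.
Qed.

Lemma flat_braid_sec2l X Y Z (x : hom 𝟏 (Y ⊗ Z)) W :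
  flat_braid X Y (Z ⊗ W) ∘ (idm X ⊠ flat_sec2 x W)
  = (idm Y ⊠ flat_braid Z X W) ∘ flat_sec2 x (X ⊗ W).
Proof.
by rewrite -flat_braid_sec2r !compA (whisker _ (flat_braidK _ _ _)) tensm_id comp1m.
Qed.

Lemma flat_braid_forml X Y (e : hom Y 𝟏) W :
  (idm X ⊠ flat_form e W) ∘ flat_braid Y X W = flat_form e (X ⊗ W).
Proof.
have E := braid_nat e (idm X). flatten_in E W.
by rewrite flat_braid_unitl comp1m => <-.
Qed.

Lemma flat_braid_formr X Y (e : hom Y 𝟏) W :
  flat_form e (X ⊗ W) ∘ flat_braid X Y W = idm X ⊠ flat_form e W.
Proof. by rewrite -flat_braid_forml -compA flat_braidK compm1. Qed.

End Braiding.

(** * Algebra laws in strict form *)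

Section FlatAlgebra.
Variables (k : fieldType) (C : tensorCategory k) (A : algData C).
Hypothesis algA : is_algebra A.

Lemma flat_mulA W :
  flat_mul A W ∘ flat_mul A (A ⊗ W) = flat_mul A W ∘ (idm A ⊠ flat_mul A W).
Proof. have [E _ _] := algA. by flatten_in E W. Qed.

Lemma flat_mul1l W : flat_mul A W ∘ flat_sec (alg_one A) (A ⊗ W) = idm _.
Proof. have [_ E _] := algA. by flatten_in E W. Qed.

Lemma flat_mul1r W : flat_mul A W ∘ (idm A ⊠ flat_sec (alg_one A) W) = idm _.
Proof. have [_ _ E] := algA. by flatten_in E W. Qed.

End FlatAlgebra.

(** * Left and right multiplication by an element *)

Section Multiplications.
Variables (k : fieldType) (C : tensorCategory k) (B : algData C).
Hypothesis algB : is_algebra B.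
Implicit Types x y : global_sections B.

Lemma flat_lmul x W :
  flat (Atom (alg_ob B)) (Atom (alg_ob B)) (lmul x) W
  = flat_mul B W ∘ flat_sec x (B ⊗ W).
Proof. by rewrite /lmul; flat_norm; flat_fold. Qed.

Lemma flat_rmul x W :
  flat (Atom (alg_ob B)) (Atom (alg_ob B)) (rmul x) W
  = flat_mul B W ∘ (idm B ⊠ flat_sec x W).
Proof. by rewrite /rmul; flat_norm; flat_fold. Qed.

Lemma rmul_mul x : rmul x ∘ alg_mul B = alg_mul B ∘ (idm B ⊠ rmul x).
Proof.
flatten; flat_fold; rewrite !flat_rmul !tensm_compr !compA.
by rewrite (comp_post (esym (flat_mul_nat _ _))) !compA flat_mulA.
Qed.

Lemma lmul_mul x : lmul x ∘ alg_mul B = alg_mul B ∘ (lmul x ⊠ idm B).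
Proof.
flatten; flat_fold; rewrite !flat_lmul !compA.
by rewrite (comp_post (flat_sec_nat _ _)) !compA flat_mulA.
Qed.

Lemma mul_rmul_lmul x :
  alg_mul B ∘ (rmul x ⊠ idm B) = alg_mul B ∘ (idm B ⊠ lmul x).
Proof.
flatten; flat_fold; rewrite flat_lmul flat_rmul !tensm_compr !compA.
by rewrite flat_mulA.
Qed.

Lemma lmul_rmulC x y : lmul x ∘ rmul y = rmul y ∘ lmul x.
Proof.
flatten; flat_fold; rewrite !flat_lmul !flat_rmul !compA.
rewrite (comp_post (flat_sec_nat _ _)) !compA -flat_mulA //.
rewrite (comp_post (flat_sec_nat _ _)) !compA.
by rewrite (comp_post (flat_mul_nat _ _)) !compA.
Qed.

Lemma lmul_one x : lmul x ∘ alg_one B = x.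
Proof.
flatten; flat_fold; rewrite flat_lmul.
by rewrite (comp_post (flat_sec_nat _ _)) !compA flat_mul1r // comp1m.
Qed.

Lemma rmul_one x : rmul x ∘ alg_one B = x.
Proof.
flatten; flat_fold; rewrite flat_rmul.
by rewrite (comp_post (esym (flat_sec_nat _ _))) !compA flat_mul1l // comp1m.
Qed.

Lemma lmul1 : lmul (alg_one B) = idm B.
Proof. by flatten; flat_fold; rewrite flat_lmul flat_mul1l. Qed.

Lemma rmul1 : rmul (alg_one B) = idm B.
Proof. by flatten; flat_fold; rewrite flat_rmul flat_mul1r. Qed.

(** Here [lmul x ∘ y] is the product x y. *)
Lemma lmul_comp x y : lmul x ∘ lmul y = lmul (B := B) (lmul x ∘ y).
Proof.
rewrite -[RHS]/(alg_mul B ∘ ((lmul x ∘ y) ⊠ idm B) ∘ luniti B) tensm_compl !compA.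
by rewrite -lmul_mul -!compA.
Qed.

(** Here [rmul x ∘ y] is the product y x, in this order. *)
Lemma rmul_comp x y : rmul x ∘ rmul y = rmul (B := B) (rmul x ∘ y).
Proof.
rewrite -[RHS]/(alg_mul B ∘ (idm B ⊠ (rmul x ∘ y)) ∘ runiti B) tensm_compr !compA.
by rewrite -rmul_mul -!compA.
Qed.

(** Left and right multiplications commute, so t(1) = x^2. Hence x^2 = 1, and then t(x) = x^3 =
    x. *)
Lemma inner_involution (x : global_sections B) (t : hom B B) :
  t = lmul x ∘ rmul x -> t ∘ alg_one B = alg_one B ->
  [/\ rmul x ∘ x = alg_one B, rmul x ∘ rmul x = idm B & t ∘ x = x].
Proof.
move=> tE t1.
have xx : rmul x ∘ x = alg_one B.
  by rewrite -t1 tE lmul_rmulC -compA lmul_one.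
split=> //; first by rewrite rmul_comp xx rmul1.
by rewrite tE -compA xx lmul_one.
Qed.

End Multiplications.

(** * The tensor product of two algebras *)

Section TensorAlgebra.
Variables (k : fieldType) (C : tensorCategory k) (A B : algData C).

Lemma flat_tens_mul W :
  flat (Tens (Tens (Atom (alg_ob A)) (Atom (alg_ob B)))
             (Tens (Atom (alg_ob A)) (Atom (alg_ob B))))
    (Tens (Atom (alg_ob A)) (Atom (alg_ob B))) (alg_mul (tens_alg A B)) W
  = flat_mul A (B ⊗ W) ∘ (idm A ⊠ (idm A ⊠ flat_mul B W))
    ∘ (idm A ⊠ flat_braid B A (B ⊗ W)).
Proof. by rewrite /= /middle_swap; flat_norm; flat_fold. Qed.

Lemma flat_tens_one W :
  flat Unit (Tens (Atom (alg_ob A)) (Atom (alg_ob B))) (alg_one (tens_alg A B)) W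
  = flat_sec (alg_one A) (B ⊗ W) ∘ flat_sec (alg_one B) W.
Proof. by rewrite /=; flat_norm; flat_fold. Qed.

End TensorAlgebra.

Section TensorAlgebraLaws.
Variables (k : fieldType) (C : tensorCategory k) (A B : algData C).
Hypotheses (algA : is_algebra A) (algB : is_algebra B).

Let S := Tens (Atom (alg_ob A)) (Atom (alg_ob B)).
Lemma tens_algP : is_algebra (tens_alg A B).
Proof.
split.
(* The shapes are given by hand: the object of [tens_alg A B] is not syntactically a tensor product,
   and its product must stay folded for [flat_tens_mul]. *)
- apply: (@flat_inj _ _ (Tens (Tens S S) S) S) => W.
  rewrite (@flat_comp _ _ _ (Tens S S)) (@flat_tens _ _ (Tens S S) S S S).
  rewrite (@flat_id _ _ S) !(@flat_comp _ _ _ (Tens S (Tens S S)));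
  rewrite (@flat_comp _ _ _ (Tens S S)) (@flat_tens _ _ S S (Tens S S) S).
  rewrite (@flat_assoc _ _ S S S) (@flat_id _ _ S) compm1 !flat_tens_mul.
  cbn [act actm S]; rewrite !tensm_id compm1 comp1m !tensm_compr !compA.
  rewrite (comp_post (esym (flat_mul_nat A (flat_braid _ _ _)))) !compA.
  rewrite (comp_post (esym (flat_mul_nat A (_ ⊠ _)))) !compA (flat_mulA algA).
  rewrite -!compA; congr (_ ∘ _); rewrite !compA -!tensm_compr; congr (_ ⊠ _).
  (* The outer product of [A] is gone from both sides. It remains to slide the products of [A] and
     [B] through braidings and to use associativity in [B]. *)
  rewrite (comp_post (flat_braid_mulr _ _ _)) !compA -[in RHS]flat_mul_nat.
  rewrite !(comp_post (flat_braid_nat _ _ _)) !compA.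
  rewrite (comp_post (flat_braid_nat _ _ _)) !compA.
  rewrite (comp_post (whisker _ (flat_braid_mull _ _ _))) !tensm_compr !compA.
  rewrite (comp_post (whisker _ (whisker _ (flat_mulA algB _)))).
  by rewrite (comp_post (whisker _ (flat_braid_nat _ _ _))) !tensm_compr !compA.
- apply: (@flat_inj _ _ (Tens Unit S) S) => W.
  rewrite (@flat_comp _ _ _ (Tens S S)) (@flat_tens _ _ Unit S S S).
  rewrite (@flat_id _ _ S) (@flat_lunit _ _ S) flat_tens_mul flat_tens_one.
  cbn [act actm S]; rewrite !compm1 !compA.
  do 2![rewrite (comp_post (esym (flat_sec_nat _ _))) !compA].
  by rewrite (flat_mul1l algA) comp1m (comp_post (flat_braid_secl _ _ _))
    (whisker _ (flat_mul1l algB _)) tensm_id.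
- apply: (@flat_inj _ _ (Tens S Unit) S) => W.
  rewrite (@flat_comp _ _ _ (Tens S S)) (@flat_tens _ _ S S Unit S).
  rewrite (@flat_id _ _ S) (@flat_runit _ _ S) flat_tens_mul flat_tens_one.
  cbn [act actm S]; rewrite !comp1m !tensm_compr !compA.
  rewrite (comp_post (whisker _ (flat_braid_secr _ _ _))).
  rewrite (comp_post (whisker _ (esym (flat_sec_nat _ _)))) !tensm_compr !compA.
  by rewrite (flat_mul1r algA) comp1m (whisker _ (flat_mul1r algB _)) tensm_id.
Qed.
End TensorAlgebraLaws.

(** * Elements that implement the symmetry by conjugation *)

Section SwapElement.
Variables (k : fieldType) (C : tensorCategory k) (A : algData C).
Hypothesis algA : is_algebra A.
Variable x : global_sections (tens_alg A A).

Let S := Tens (Atom (alg_ob A)) (Atom (alg_ob A)).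

Lemma flat_tens_lmul W :
  flat S S (lmul x) W
  = flat_mul A (A ⊗ W) ∘ (idm A ⊠ (idm A ⊠ flat_mul A W))
    ∘ (idm A ⊠ flat_braid A A (A ⊗ W)) ∘ flat_sec2 x (A ⊗ (A ⊗ W)).
Proof. by rewrite /S /lmul /= /middle_swap; flat_norm; flat_fold. Qed.

Lemma flat_tens_rmul W :
  flat S S (rmul x) W
  = flat_mul A (A ⊗ W) ∘ (idm A ⊠ (idm A ⊠ flat_mul A W))
    ∘ (idm A ⊠ flat_braid A A (A ⊗ W)) ∘ (idm A ⊠ (idm A ⊠ flat_sec2 x W)).
Proof. by rewrite /S /rmul /= /middle_swap; flat_norm; flat_fold. Qed.

Lemma braid_tens_one : braid A A ∘ alg_one (tens_alg A A) = alg_one (tens_alg A A).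
Proof.
rewrite /=; flatten; flat_fold.
by rewrite flat_braid_secl -flat_sec_nat.
Qed.

Hypothesis xP : braid A A = lmul x ∘ rmul x.
Hypothesis rmulxK : rmul x ∘ rmul x = idm _.

(** Since tau(y) = x y x and x^2 = 1, one gets tau(y) x = x y. The next two lemmas evaluate this on
    each tensor factor. *)
Lemma rmul_braid : rmul x ∘ braid A A = lmul x.
Proof.
rewrite xP compA -lmul_rmulC; last exact: tens_algP.
by rewrite -[LHS]compA rmulxK compm1.
Qed.

(* Writing x = p ⊗ q (a sum), this is p ⊗ bq = pb ⊗ q. *)
Lemma swap_sec_in W :
  (idm A ⊠ flat_mul A W) ∘ flat_braid A A (A ⊗ W) ∘ (idm A ⊠ flat_sec2 x W)
  = flat_mul A (A ⊗ W) ∘ (idm A ⊠ flat_braid A A W) ∘ flat_sec2 x (A ⊗ W).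
Proof.
(* Evaluation at y = b ⊗ 1. *)
have E := congr1 (fun f => flat S S f W ∘ (idm A ⊠ flat_sec (alg_one A) W)) rmul_braid.
move: E; rewrite (@flat_comp _ _ S S S) flat_tens_rmul flat_tens_lmul /=.
rewrite -/(flat_braid A A W) (comp_post (flat_braid_secr _ _ _)).
do 3![rewrite (comp_post (esym (flat_sec_nat _ _))) !compA].
rewrite (flat_mul1l algA) comp1m => ->.
rewrite (comp_post (flat_sec2_nat _ _)) !compA.
rewrite (comp_post (whisker _ (flat_braid_nat _ _ _))) !tensm_compr !compA.
by rewrite (comp_post (whisker _ (whisker _ (flat_mul1r algA _)))) !tensm_id compm1.
Qed.

(* In the same notation, ap ⊗ q = p ⊗ qa. *)
Lemma swap_sec_out W :
  flat_mul A (A ⊗ W) ∘ (idm A ⊠ flat_sec2 x W)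
  = (idm A ⊠ flat_mul A W) ∘ flat_sec2 x (A ⊗ W).
Proof.
(* Evaluation at y = 1 ⊗ a. *)
have E := congr1 (fun f => flat S S f W ∘ flat_sec (alg_one A) (A ⊗ W)) rmul_braid.
move: E; rewrite (@flat_comp _ _ S S S) flat_tens_rmul flat_tens_lmul /=.
rewrite -/(flat_braid A A W) (comp_post (flat_braid_secl _ _ _)).
rewrite (comp_post (whisker _ (esym (flat_sec_nat _ _)))) !tensm_compr !compA.
rewrite (comp_post (whisker _ (flat_braid_secl _ _ _))).
rewrite (comp_post (whisker _ (whisker _ (flat_mul1l algA _)))) !tensm_id compm1 => ->.
rewrite (comp_post (flat_sec2_nat _ _)) !compA.
rewrite (comp_post (whisker _ (flat_braid_secr _ _ _))).
rewrite (comp_post (whisker _ (esym (flat_sec_nat _ _)))) !tensm_compr !compA.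
by rewrite (flat_mul1r algA) comp1m.
Qed.

End SwapElement.

(** * Bimodule maps from B to its twist *)

Section TwistedBimodule.
Variables (k : fieldType) (C : tensorCategory k) (B : algData C).
Hypothesis algB : is_algebra B.

(** Left linearity is associativity. Right linearity for the twisted action reads y b x = (y x)(x b
    x), which follows from x^2 = 1. *)
Lemma rmul_twist_hom (x : global_sections B) (t : hom B B) :
  t = lmul x ∘ rmul x -> rmul x ∘ rmul x = idm B ->
  @is_bimod_hom k C B (regular_bimod B) (twist_bimod t (regular_bimod B)) (rmul x).
Proof.
move=> -> xx; apply/andP; split; apply/eqP; rewrite /= rmul_mul //.
rewrite tensm_compr !compA -mul_rmul_lmul // (comp_post (esym (tensm_exch _ _))).
by rewrite !compA (comp_post (esym (tensm_compl _ _ _))) xx tensm_id compm1.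
Qed.

Lemma twist_hom_inner (t i : hom B B) :
  @is_bimod_hom k C B (regular_bimod B) (twist_bimod t (regular_bimod B)) i ->
  i ∘ i = idm B ->
  exists2 u : global_sections B, i = rmul u & t = lmul u ∘ rmul u.
Proof.
case/andP=> /eqP /= il /eqP /= ir ii; set u : global_sections B := i ∘ alg_one B.
have [_ mul1l mul1r] := algB.
(* Left linearity at 1: i(b) = b i(1). *)
have iE : i = rmul u.
  rewrite /rmul tensm_compr !compA -il (comp_post mul1r).
  by rewrite -compA runitiK compm1.
(* Twisted right linearity at 1: i(b) = i(1) t(b). *)
have itE : i = lmul u ∘ t.
  rewrite /lmul -[RHS]compA luniti_nat !compA.
  rewrite (comp_post (tensm_exch _ _)) tensm_compl !compA -ir.
  by rewrite (comp_post mul1l) -compA lunitiK compm1.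
have uu : lmul u ∘ u = alg_one B.
  transitivity (lmul u ∘ (rmul u ∘ alg_one B)); first by rewrite rmul_one.
  by rewrite compA lmul_rmulC // -compA lmul_one // -iE /u compA ii comp1m.
exists u => //; rewrite -iE [in RHS]itE compA lmul_comp // uu.
by rewrite lmul1 // comp1m.
Qed.
End TwistedBimodule.

(** * From an S-structure to an Azumaya algebra with trivial invariant *)

Section SStructure.
Variables (k : fieldType) (C : tensorCategory k) (A : algData C).
Hypothesis algA : is_algebra A.
Variables (pi : global_sections (tens_alg A A)) (eps : hom A 𝟏).
Hypothesis piP : is_S_structure pi eps.

Let algAA : is_algebra (tens_alg A A) := tens_algP algA algA.
Let braidE : braid A A = lmul pi ∘ rmul pi := proj1 piP.
Let piK : rmul pi ∘ rmul pi = idm (tens_alg A A).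
Proof. by have [] := inner_involution algAA braidE (braid_tens_one A). Qed.

Lemma S_structure_eta_trivial : eta_trivial A.
Proof.
exists (rmul pi); split; [exact: rmul_twist_hom | by exists (rmul pi) | exact: piK].
Qed.

(** With pi = p ⊗ q this is p eps(q) = 1, obtained by evaluating mul = (id ⊗ eps) ρ_pi at 1 ⊗ 1. *)
Lemma flat_counit W : (idm A ⊠ flat_form eps W) ∘ flat_sec2 pi W = flat_sec (alg_one A) W.
Proof.
have E : runit A ∘ (idm A ⊠ eps) ∘ pi = alg_one A.
  rewrite -[pi in LHS](rmul_one algAA) compA -(proj2 piP) /=.
  by flatten; flat_fold; rewrite flat_mul1l ?comp1m.
by flatten_in E W.
Qed.

Lemma flat_braid_sec W : flat_braid A A W ∘ flat_sec2 pi W = flat_sec2 pi W.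
Proof.
have [_ _ /= E] := inner_involution algAA braidE (braid_tens_one A).
by flatten_in E W.
Qed.

Let sec_in := swap_sec_in algA braidE piK.
Let sec_out := swap_sec_out algA braidE piK.

(** By [sec_out], p eps(q a) = a p eps(q) = a. *)
Lemma flat_zig W :
  (idm A ⊠ flat_form eps W) ∘ (idm A ⊠ flat_mul A W) ∘ flat_sec2 pi (A ⊗ W) = idm _.
Proof.
rewrite (comp_post (esym (sec_out _))) !compA -flat_mul_nat.
by rewrite (comp_post (whisker _ (flat_counit _))) flat_mul1r.
Qed.

(** As pi is symmetric, eps(a p) q = p eps(a q), and by [sec_in] this is p a eps(q) = a. *)
Lemma flat_zag W :
  flat_form eps (A ⊗ W) ∘ flat_mul A (A ⊗ W) ∘ (idm A ⊠ flat_sec2 pi W) = idm _.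
Proof.
rewrite -flat_braid_sec tensm_compr !compA.
have -> : flat_form eps (A ⊗ W) ∘ flat_mul A (A ⊗ W) ∘ (idm A ⊠ flat_braid A A W)
   = (idm A ⊠ flat_form eps W) ∘ (idm A ⊠ flat_mul A W) ∘ flat_braid A A (A ⊗ W).
  rewrite -flat_braid_formr (comp_post (flat_braid_mulr _ _ _)) !compA.
  by rewrite (comp_post (flat_braidK _ _ _)) compm1.
rewrite (comp_post3 (sec_in _)) !compA -flat_mul_nat.
rewrite (comp_post (whisker _ (flat_braid_forml _ _ _))).
by rewrite (comp_post (flat_counit _)) flat_mul1l.
Qed.

Lemma dual_zigP :
  runit A ∘ (idm A ⊠ (eps ∘ alg_mul A)) ∘ assoc A A A ∘ (pi ⊠ idm A)
    ∘ luniti A = idm A.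
Proof. by rewrite /=; flatten; flat_fold; exact: flat_zig. Qed.

Lemma dual_zagP :
  lunit A ∘ ((eps ∘ alg_mul A) ⊠ idm A) ∘ associ A A A ∘ (idm A ⊠ pi)
    ∘ runiti A = idm A.
Proof. by rewrite /=; flatten; flat_fold; exact: flat_zag. Qed.

Definition self_dual : dual A := Dual dual_zigP dual_zagP.

(** The equality a p b ⊗ q = a p ⊗ b q is [sec_in] multiplied on the left by a. *)
Lemma curry_sandwich : curry_end self_dual (sandwich A) = rmul pi.
Proof.
pose S := Tens (Atom (alg_ob A)) (Atom (alg_ob A)).
apply: (@flat_inj _ _ S S) => W.
rewrite flat_tens_rmul /curry_end /sandwich /=; flat_norm; flat_fold.
rewrite -!compA; congr (_ ∘ _); rewrite !compA -!tensm_compr; congr (_ ⊠ _).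
by rewrite sec_in -!compA -flat_braid_sec2l.
Qed.

Lemma S_structure_azumaya : is_azumaya A.
Proof.
exists self_dual; rewrite curry_sandwich; by exists (rmul pi).
Qed.
End SStructure.

(** * From an Azumaya algebra with trivial invariant to an S-structure *)

Lemma equivalence_full (C D : category) (F : functor C D) :
  is_equivalence F ->
  forall (X Y : C) (g : cat_hom (F X) (F Y)), exists f : cat_hom X Y, fun_hom F f = g.
Proof.
case=> G [[t [tnat tiso]] [s [snat siso]]] X Y g.
(* The quasi-inverse G is faithful: h is F(G(h)) conjugated by the isomorphism [s]. *)
have faithfulG (P Q : D) (h h' : cat_hom P Q) : fun_hom G h = fun_hom G h' -> h = h'.
  have [si [_ ssi]] := siso P.
  move=> /(congr1 (fun h => cat_comp (s Q) (cat_comp (fun_hom F h) si))).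
  have /= natE (e : cat_hom P Q) := snat P Q e.
  by rewrite !cat_compA !natE -!cat_compA ssi !cat_compm1.
have [ty [_ tyK]] := tiso Y; have [tx [_ txK]] := tiso X.
(* The preimage is t_Y^-1 ∘ G(g) ∘ t_X; naturality of t shows that G sends its image under F to
   G(g). *)
exists (cat_comp ty (cat_comp (fun_hom G g) (t X))); apply: faithfulG.
have /= := tnat X Y (cat_comp ty (cat_comp (fun_hom G g) (t X))).
rewrite [LHS]cat_compA tyK cat_comp1m => /(congr1 (fun h => cat_comp h tx)).
by rewrite -!cat_compA txK !cat_compm1.
Qed.

Section AzumayaSwap.
Variables (k : fieldType) (C : tensorCategory k) (A : algebra C).
Let algA : is_algebra A := algebraP A.
Variable u : global_sections (tens_alg A A).
Hypothesis uP : braid A A = lmul u ∘ rmul u.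
Hypothesis uK : rmul u ∘ rmul u = idm (tens_alg A A).

Let S := Tens (Atom (alg_ob A)) (Atom (alg_ob A)).

(* Writing u = p ⊗ q, this is b |-> p b q. *)
Definition flat_sum W : hom (A ⊗ W) (A ⊗ W) :=
  flat_mul A W ∘ (idm A ⊠ flat_mul A W) ∘ flat_braid A A (A ⊗ W)
  ∘ (idm A ⊠ flat_sec2 u W).

(** As [flat_sum] is defined as a composite of families and not by [flat], its naturality is
    assembled from that of the factors. *)
Lemma flat_sum_nat W W' (f : hom W W') :
  flat_sum W' ∘ (idm A ⊠ f) = (idm A ⊠ f) ∘ flat_sum W.
Proof.
rewrite /flat_sum (comp_post (whisker _ (flat_sec2_nat _ _))) !tensm_compr !compA.
rewrite (comp_post (flat_braid_nat _ _ _)) !compA.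
by rewrite (comp_post (whisker _ (flat_mul_nat _ _))) !tensm_compr !compA flat_mul_nat.
Qed.

(* Here c p b q = p b q c, since cp ⊗ q = p ⊗ qc. *)
Lemma flat_sum_central W :
  flat_mul A W ∘ (idm A ⊠ flat_sum W)
  = flat_mul A W ∘ flat_sum (A ⊗ W) ∘ flat_braid A A W.
Proof.
rewrite /flat_sum !tensm_compr !compA.
rewrite (comp_post (whisker _ (flat_braid_sec2l _ _ _))) !tensm_compr !compA.
rewrite -(flat_mulA algA) (comp_post (flat_mul_nat _ _)) !compA.
rewrite (comp_post (flat_mul_nat _ _)) !compA (comp_post (swap_sec_out algA uP uK _)) !compA.
rewrite (comp_post (whisker _ (flat_braid_mull _ _ _))) !tensm_compr !compA.
rewrite (flat_mulA algA) (comp_post (whisker _ (flat_mulA algA _))) !tensm_compr !compA.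
rewrite [in RHS](comp_post (flat_braid_sec2l _ _ _)) !compA.
by rewrite (comp_post (flat_sec2_nat _ _)) !compA.
Qed.

(** Both sides are a ⊗ b ↦ a p b q. *)
Lemma flat_mul_rmul W :
  flat_mul A W ∘ flat S S (rmul u) W = flat_mul A W ∘ (idm A ⊠ flat_sum W).
Proof. by rewrite flat_tens_rmul /flat_sum !tensm_compr !compA flat_mulA. Qed.

(* b ⊗ a |-> a p b q *)
Let phi : hom (A ⊗ A) A := alg_mul A ∘ rmul u ∘ braid A A.

Lemma flat_phi W :
  flat (Tens (Atom (alg_ob A)) (Atom (alg_ob A))) (Atom (alg_ob A)) phi W
  = flat_mul A W ∘ (idm A ⊠ flat_sum W) ∘ flat_braid A A W.
Proof.
rewrite /phi (@flat_comp _ _ _ S) (@flat_comp _ _ _ S).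
by rewrite -/(flat_mul A W) flat_mul_rmul.
Qed.

(** The factor b is a parameter. Left linearity in a is associativity; right linearity is a c p b q
    = a p b q c, the centrality of p b q. The map [luniti] identifies A with 𝟏 ⊗ A. *)
Lemma phi_bimod_hom :
  is_bimod_hom (M := tens_bimod A A) (N := tens_bimod A 𝟏) (luniti A ∘ phi).
Proof.
move: flat_phi flat_sum_nat flat_sum_central.
(* Generalising hides both bodies from the normalisation; only their three laws remain. *)
move: phi flat_sum => f sum fE sumN sumC.
apply/andP; split; apply/eqP; rewrite /= /tens_bimod_lact /tens_bimod_ract.
  flatten; flat_fold; rewrite !fE flat_braid_unitr compm1 !tensm_compr !compA.
  rewrite (comp_post (flat_braid_mulr _ _ _)) !compA.
  rewrite (comp_post (flat_braidK _ _ _)) compm1.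
  by rewrite (comp_post (esym (flat_mul_nat _ _))) !compA flat_mulA.
flatten; flat_fold; rewrite !fE ?compA.
rewrite (comp_post (flat_braid_mulr _ _ _)) !compA.
rewrite (comp_post (esym (flat_mul_nat _ _))) !compA flat_mulA //.
rewrite (comp_post (whisker _ (sumC _))) !tensm_compr !compA.
by rewrite (comp_post (whisker _ (flat_braidK _ _ _))) tensm_id compm1.
Qed.

Lemma swap_S_structure :
  is_equivalence (tens_bimod_functor A) -> admits_S_structure A.
Proof.
move=> /equivalence_full full.
pose g : bimod_hom (tens_bimod A A) (tens_bimod A 𝟏) :=
  exist (@is_bimod_hom k C A (tens_bimod A A) (tens_bimod A 𝟏)) _ phi_bimod_hom.
(* Fullness at X = A, Y = 𝟏 gives eps with eps(b) a = a p b q. *)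
have [eps /(congr1 val) /= epsE] := full (alg_ob A) (@tunit k C) g.
exists u, eps; split=> //.
have -> : runit A ∘ (idm A ⊠ eps) = alg_mul A ∘ rmul u.
  rewrite -lunit_braid (comp_post (braid_nat _ _)) epsE !compA lunitiK comp1m.
  by rewrite (comp_post (braidK _ _)) compm1.
(* Precomposing mul ∘ ρ_u with ρ_u gives mul, as u^2 = 1. *)
by rewrite -compA uK compm1.
Qed.

End AzumayaSwap.

Theorem theorem3p13 (k : fieldType) (C : tensorCategory k) (A : algebra C) :
  (is_azumaya A -> eta_trivial A -> is_equivalence (tens_bimod_functor A) ->
     admits_S_structure A) /\
  (admits_S_structure A -> is_azumaya A /\ eta_trivial A).
Proof.
have algAA := tens_algP (algebraP A) (algebraP A).
split=> [_ [i [ihom _ iK]] | [pi [eps piP]]].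
  have [u iE braidE] := twist_hom_inner algAA ihom iK.
  by apply: (swap_S_structure braidE); rewrite -iE.
split; first exact: (S_structure_azumaya (algebraP A) piP).
exact: (S_structure_eta_trivial (algebraP A) piP).
Qed.
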